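(* Fix $p\in(0,1)$, and for each $n\ge 1$ let $G_n\in\mathcal{G}(n,p)$ be an Erdős–Rényi random graph. Then the probability that the domination polynomial $D(G_n,x)$ is unimodal with mode $\lceil \frac{n}{2}\rceil$ tends to $1$ as $n\to\infty$.
   Context: $\mathcal{G}(n,p)$ denotes the Erdős–Rényi random graph model on $n$ vertices: each of the $\binom{n}{2}$ possible edges is present independently with probability $p$. A subset $S$ of the vertices of a finite simple graph $G$ is a dominating set if every vertex of $G$ is either in $S$ or adjacent to a vertex of $S$. Let $d_i(G)$ be the number of dominating sets of $G$ of cardinality $i$. The domination polynomial of $G$ is $D(G,x)=\sum_{i} d_i(G)x^i$, where $0\le i\le |V(G)|$ (coefficients below the domination number are $0$). A real polynomial $a_0+a_1x+\cdots+a_nx^n$ is unimodal with mode $k$ (where $0\le k\le n$) if $a_0\le a_1\le\cdots\le a_k\ge a_{k+1}\ge\cdots\ge a_n$; the mode need not be unique. *)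

(* Defs.v *)
From HB Require Import structures.
From mathcomp Require Import all_boot all_order all_algebra.
From mathcomp Require Import reals.

Set Implicit Arguments.
Unset Strict Implicit.
Unset Printing Implicit Defensive.

Import Order.TTheory GRing.Theory Num.Theory.

Local Open Scope ring_scope.

(* The edges of the complete graph on T: the unordered pairs {u, v}, u <> v.  *)
Definition vertex_pairs (T : finType) : {set {set T}} :=
  [set e : {set T} | #|e| == 2%N].

(* A finite simple graph on the vertex set T, given by its edge set.          *)
Record sgraph (T : finType) : Type := SGraph {
  edges : {set {set T}};
  edges_sub : edges \subset vertex_pairs T }.

HB.instance Definition _ (T : finType) := [isSub for @edges T].
HB.instance Definition _ (T : finType) := [Finite of sgraph T by <:].

Definition adjacent (T : finType) (G : sgraph T) : rel T :=
  fun u v => [set u; v] \in edges G.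

Definition dominating (T : finType) (G : sgraph T) (S : {set T}) : bool :=
  [forall v, (v \in S) || [exists u in S, adjacent G u v]].

Definition dom_count (T : finType) (G : sgraph T) (i : nat) : nat :=
  #|[set S : {set T} | dominating G S & #|S| == i]|.

Definition domination_poly (R : realType) (T : finType) (G : sgraph T)
  : {poly R} := \poly_(i < #|T|.+1) (dom_count G i)%:R.

(* (size q).-1 is the degree of q; the coefficients compared are those of     *)
(* index 0, ..., deg q.                                                       *)
Definition unimodal_with_mode (R : realType) (q : {poly R}) (k : nat) : bool :=
  [&& (k <= (size q).-1)%N,
      [forall i : 'I_k, q`_i <= q`_i.+1] &
      [forall i : 'I_(size q).-1, (k <= i)%N ==> (q`_i.+1 <= q`_i)]].

Section ErdosRenyi.
Variables (R : realType) (n : nat) (p : R).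

(* Product of Bernoulli(p) laws over the 'C(n, 2) possible edges.             *)
Definition gnp_mass (G : sgraph 'I_n) : R :=
  \prod_(e in vertex_pairs 'I_n) (if e \in edges G then p else 1 - p).

Definition gnp_prob (A : pred (sgraph 'I_n)) : R :=
  \sum_(G : sgraph 'I_n | A G) gnp_mass G.

(* Distinct edges are present independently, each with probability p.         *)
Lemma gnp_prob_edges (F : {set {set 'I_n}}) : F \subset vertex_pairs 'I_n ->
  gnp_prob (fun G => F \subset edges G) = p ^+ #|F|.
Proof.
move=> sFD; set D := vertex_pairs 'I_n.
pose f (e : {set 'I_n}) : R := if e \in D then p else 0.
pose g (e : {set 'I_n}) : R :=
  if e \in F then 0 else if e \in D then 1 - p else 1.
transitivity (\prod_(e : {set 'I_n}) (f e + g e)); last first.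
  rewrite (bigID (mem F)) /= [X in _ * X]big1 ?mulr1 => [|e /negbTE eF].
    rewrite -prodr_const; apply: eq_bigr => e eF.
    by rewrite /f /g eF (subsetP sFD _ eF) addr0.
  by rewrite /f /g eF; case: ifP => _; rewrite ?add0r // addrC subrK.
rewrite bigA_distr.
rewrite [RHS](bigID (fun J : {set {set 'I_n}} =>
  (J \subset D) && (F \subset J))) /=.
rewrite [X in _ = _ + X]big1 ?addr0 => [|J]; last first.
  rewrite negb_and => /orP[/subsetPn|/subsetPn] [e eJ eN];
    rewrite (bigD1 e) //= ?eJ ?(negbTE eN) /f /g ?eJ ?(negbTE eN) ?mul0r //.
rewrite /gnp_prob.
rewrite [RHS](reindex_omap (@edges _) insub)
  /= => [|J /andP[JD _]]; last by rewrite insubT.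
apply: eq_big => [G|G FG].
  by rewrite valK eqxx andbT /edges (edges_sub G).
rewrite /gnp_mass [RHS](bigID (mem D)) /= [X in _ = _ * X]big1 ?mulr1.
  apply: eq_bigr => e eD; rewrite /f /g eD; case: ifP => // eG.
  by case: ifP => // /(subsetP FG); rewrite eG.
move=> e eD; rewrite /f /g (negbTE eD).
case: ifP => [/(subsetP (edges_sub G)) eD'|_]; first by rewrite eD' in eD.
by case: ifP => // /(subsetP sFD) eD'; rewrite eD' in eD.
Qed.

Lemma gnp_mass_sum1 : \sum_(G : sgraph 'I_n) gnp_mass G = 1.
Proof.
have := gnp_prob_edges (sub0set _); rewrite cards0 expr0 /gnp_prob => <-.
by apply: eq_bigl => G; rewrite sub0set.
Qed.

End ErdosRenyi.

(* Main.v *)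
(* Supersets of dominating sets dominate, so counting pairs (S, x) with x not in S
   gives d_i (n - i) <= d_(i+1) (i + 1), which makes the sequence nondecreasing up
   to ceil(n/2) for every graph.  Past the middle C(n, i) - C(n, i+1) is at least
   C(n, i) / (i + 1), so d_(i+1) <= d_i as soon as at most a fraction 1 / (i + 1)
   of the sets of size i fail to dominate.  A fixed set of size i fails with
   probability at most n (1 - p)^i, so Markov's inequality and a union bound over
   i >= n/2 bound the probability of a bad graph by n^3 (1 - p)^ceil(n/2). *)
Require Import Defs.
From mathcomp Require Import all_boot all_order all_algebra.
From mathcomp Require Import all_classical all_reals all_analysis.
From mathcomp Require Import zify lra.
Import Order.TTheory GRing.Theory Num.Theory.
Import numFieldNormedType.Exports.
Import fintype mathcomp.boot.finset.
Local Open Scope ring_scope.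

(** * Counting dominating sets by size, for a fixed graph *)

Lemma card_upset_layer (T : finType) (P : pred {set T}) (i : nat) :
  (forall A B : {set T}, A \subset B -> P A -> P B) ->
  (#|[set S : {set T} | P S & #|S| == i]| * (#|T| - i) <=
   #|[set S : {set T} | P S & #|S| == i.+1]| * i.+1)%N.
Proof.
move=> upP; set A := finset _; set B := finset _.
pose X := [set u : {set T} * T | (u.1 \in A) && (u.2 \notin u.1)].
pose Y := [set u : {set T} * T | (u.1 \in B) && (u.2 \in u.1)].
have cardE (C : {set {set T}}) (Q : {set T} -> {set T}) k :
    (forall S, S \in C -> #|Q S| = k) ->
    #|[set u : {set T} * T | (u.1 \in C) && (u.2 \in Q u.1)]| = (#|C| * k)%N.
  move=> CQ; rewrite -sum_nat_const -sum1dep_card.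
  rewrite -(pair_big_dep (mem C) (fun S x => x \in Q S) (fun _ _ => 1%N)) /=.
  by apply: eq_bigr => S SC; rewrite sum1_card CQ.
have -> : (#|A| * (#|T| - i) = #|X|)%N.
  rewrite -(cardE A (fun S => ~: S)) => [|S]; last first.
    by rewrite inE => /andP[_ /eqP <-]; rewrite -(cardsC S) addKn.
  by apply: eq_card => u; rewrite !inE.
have -> : (#|B| * i.+1 = #|Y|)%N.
  by rewrite -(cardE B id) => [//|S]; rewrite inE => /andP[_ /eqP].
(* Keeping [x] in the image makes the map injective: [S] is recovered by deleting [x]. *)
pose f (u : {set T} * T) := (u.2 |: u.1, u.2).
have f_inj : {in X &, injective f}.
  move=> [S x] [S' y]; rewrite !inE /= => /andP[_ xS] /andP[_ yS'] [eS exy].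
  by rewrite -exy in yS' eS *; rewrite -(setU1K xS) eS setU1K.
rewrite -(card_in_imset f_inj); apply/subset_leq_card/subsetP => u /imsetP[[S x]].
rewrite !inE /= => /andP[/andP[PS /eqP cS] xS] -> /=.
by rewrite setU11 cardsU1 xS cS eqxx !andbT (upP _ _ (subsetUr _ _) PS).
Qed.

Section DominatingSets.
Variables (T : finType) (G : sgraph T).

Lemma dominatingS (A B : {set T}) :
  A \subset B -> dominating G A -> dominating G B.
Proof.
move=> sAB /forallP domA; apply/forallP => v.
case/orP: (domA v) => [/(subsetP sAB) -> //|/existsP[u /andP[uA adj_uv]]].
by apply/orP; right; apply/existsP; exists u; rewrite (subsetP sAB).
Qed.

(** This makes the leading coefficient nonzero, so the degree of the domination polynomial is
    exactly [#|T|]. *)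
Lemma dom_count_full : dom_count G #|T| = 1%N.
Proof.
rewrite /dom_count -(cards1 [set: T]); apply: eq_card => S; rewrite !inE.
apply/andP/eqP => [[_ /eqP cS]|->].
  by apply/eqP; rewrite eqEcard subsetT cardsT cS leqnn.
by rewrite cardsT eqxx; split=> //; apply/forallP => v; rewrite inE.
Qed.

Lemma dom_count_le_succ (i : nat) :
  (i < uphalf #|T|)%N -> (dom_count G i <= dom_count G i.+1)%N.
Proof.
move=> lt_i; have := card_upset_layer T (dominating G) i dominatingS.
rewrite -!/(dom_count G _) => le_layer.
rewrite -(leq_pmul2r (ltn0Sn i)); apply: leq_trans le_layer.
(* Below the middle, [i.+1 <= #|T| - i]. *)
rewrite leq_mul2l; lia.
Qed.

Definition nondom_count (i : nat) : nat :=
  #|[set S : {set T} | ~~ dominating G S & #|S| == i]|.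

Lemma dom_nondom_count (i : nat) :
  (dom_count G i + nondom_count i)%N = 'C(#|T|, i).
Proof.
rewrite -(card_draws T i) -(cardsID [set S | dominating G S] [set A | _]).
by congr (_ + _)%N; apply: eq_card => S; rewrite !inE andbC.
Qed.

Lemma dom_count_ge_succ (i : nat) : (uphalf #|T| <= i)%N ->
  (nondom_count i * i.+1 <= 'C(#|T|, i))%N ->
  (dom_count G i.+1 <= dom_count G i)%N.
Proof.
move=> le_i few; have e1 := dom_nondom_count i.
have e2 := dom_nondom_count i.+1; have e3 := mul_bin_left #|T| i.
suff : ('C(#|T|, i.+1) + nondom_count i <= 'C(#|T|, i))%N by lia.
rewrite -(leq_pmul2l (ltn0Sn i)) mulnDr e3.
(* Past the middle [#|T| - i <= i]; the successor provides a spare copy of ['C(#|T|, i)], which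
   absorbs [i.+1 * nondom_count i]. *)
have : ((#|T| - i).+1 * 'C(#|T|, i) <= i.+1 * 'C(#|T|, i))%N.
  by rewrite leq_mul2r; lia.
rewrite mulSn; lia.
Qed.

Lemma domination_poly_unimodal (R : realType) :
  (forall i, (uphalf #|T| <= i < #|T|)%N ->
     (nondom_count i * i.+1 <= 'C(#|T|, i))%N) ->
  unimodal_with_mode (domination_poly R G) (uphalf #|T|).
Proof.
move=> few; have size_q : size (domination_poly R G) = #|T|.+1.
  by apply: size_poly_eq; rewrite dom_count_full oner_neq0.
have coef_q i : (i <= #|T|)%N -> (domination_poly R G)`_i = (dom_count G i)%:R.
  by move=> le_i; rewrite coef_poly ltnS le_i.
have half_le : (uphalf #|T| <= #|T|)%N by lia.
rewrite /unimodal_with_mode size_q /=; apply/and3P; split=> //.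
  apply/forallP => -[i lt_i] /=; have le_i := leq_trans lt_i half_le.
  by rewrite !coef_q ?ler_nat ?dom_count_le_succ // ltnW.
apply/forallP => -[i lt_i] /=; apply/implyP => le_i.
by rewrite !coef_q ?ler_nat ?dom_count_ge_succ ?few ?le_i // ltnW.
Qed.

End DominatingSets.

(** * Probability bounds in the random graph *)

Section RandomGraph.
Variables (R : realType) (n : nat).

Lemma compl_edges_sub (G : sgraph 'I_n) :
  vertex_pairs 'I_n :\: edges G \subset vertex_pairs 'I_n.
Proof. exact: subsetDl. Qed.

(** Complementation exchanges the laws of parameters [p] and [1 - p], which turns the formula for
    present edges into one for absent edges. *)
Definition compl_graph (G : sgraph 'I_n) : sgraph 'I_n :=
  SGraph (compl_edges_sub G).

Lemma compl_graphK : involutive compl_graph.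
Proof.
move=> G; apply: val_inj => /=; rewrite setDDr setDv set0U.
exact/setIidPr/edges_sub.
Qed.

Lemma gnp_mass_compl (p : R) (G : sgraph 'I_n) :
  gnp_mass p (compl_graph G) = gnp_mass (1 - p) G.
Proof.
apply: eq_bigr => e eD; rewrite /= inE eD andbT.
by case: (e \in edges G) => //=; rewrite subKr.
Qed.

Lemma gnp_prob_nonedges (p : R) (F : {set {set 'I_n}}) :
  F \subset vertex_pairs 'I_n ->
  gnp_prob p (fun G => [disjoint F & edges G]) = (1 - p) ^+ #|F|.
Proof.
move=> sFD; rewrite -gnp_prob_edges //.
rewrite /gnp_prob (reindex_inj (inv_inj compl_graphK)) /=.
apply: eq_big => [G|G _]; last exact: gnp_mass_compl.
rewrite disjoints_subset; apply/subsetP/subsetP => sFG e eF; have := sFG e eF;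
  by rewrite in_setC in_setD (subsetP sFD) // andbT negbK.
Qed.

Lemma gnp_mass_ge0 (p : R) (G : sgraph 'I_n) : 0 <= p <= 1 -> 0 <= gnp_mass p G.
Proof. by move=> /andP[p0 p1]; apply: prodr_ge0 => e _; case: ifP; lra. Qed.

Lemma gnp_probE (p : R) (A : pred (sgraph 'I_n)) :
  gnp_prob p A = \sum_G gnp_mass p G * (A G)%:R.
Proof.
rewrite /gnp_prob big_mkcond; apply: eq_bigr => G _.
by case: (A G); rewrite ?mulr1 ?mulr0.
Qed.

(** Union bound: on every graph the indicator of [A] is at most the sum of the indicators of the
    [B i]. *)
Lemma gnp_prob_union (p : R) (I : finType) (A : pred (sgraph 'I_n)) (P : pred I)
    (B : I -> pred (sgraph 'I_n)) : 0 <= p <= 1 ->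
  (forall G, A G -> exists2 i, P i & B i G) ->
  gnp_prob p A <= \sum_(i | P i) gnp_prob p (B i).
Proof.
move=> p01 AB; under eq_bigr do rewrite gnp_probE.
rewrite gnp_probE exchange_big /=; apply: ler_sum => G _.
rewrite -mulr_sumr ler_wpM2l ?gnp_mass_ge0 //.
case AG: (A G); last by apply: sumr_ge0 => i _; rewrite ler0n.
have [i Pi BiG] := AB _ AG; rewrite (bigD1 i) //= BiG lerDl.
by apply: sumr_ge0 => j _; rewrite ler0n.
Qed.

(** As [v] lies outside [S], the pairs [[set u; v]] with [u] in [S] are [#|S|] distinct possible
    edges. *)
Lemma gnp_prob_isolated (p : R) (S : {set 'I_n}) (v : 'I_n) : v \notin S ->
  gnp_prob p (fun G => [forall u in S, ~~ Defs.adjacent G u v]) = (1 - p) ^+ #|S|.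
Proof.
move=> vS; pose F := [set [set u; v] | u in S].
have neq_v u : u \in S -> u != v by move=> uS; apply: contraNneq vS => <-.
have <- : #|F| = #|S|.
  apply: card_in_imset => u u' uS u'S eq_uv.
  have : u \in [set u'; v] by rewrite -eq_uv set21.
  by rewrite in_set2 (negbTE (neq_v _ uS)) orbF => /eqP.
rewrite -gnp_prob_nonedges; last first.
  by apply/subsetP => _ /imsetP[u uS ->]; rewrite inE cards2 neq_v.
apply: eq_bigl => G; rewrite disjoints_subset; apply/forall_inP/subsetP => [noadj|noadj u uS].
  by move=> _ /imsetP[u uS ->]; rewrite inE; apply: noadj.
by have := noadj [set u; v] (imset_f _ uS); rewrite inE.
Qed.

(** If [S] does not dominate, some [v] outside [S] has no neighbour in [S]; there are at most [n]
    choices of [v]. *)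
Lemma gnp_prob_nondominating (p : R) (S : {set 'I_n}) : 0 <= p <= 1 ->
  gnp_prob p (fun G => ~~ dominating G S) <= n%:R * (1 - p) ^+ #|S|.
Proof.
move=> p01; apply: le_trans (_ : \sum_(v | v \notin S) (1 - p) ^+ #|S| <= _).
  rewrite -(eq_bigr _ (fun v => gnp_prob_isolated p S v)).
  apply: gnp_prob_union => // G; rewrite negb_forall => /existsP[v].
  rewrite negb_or => /andP[vS]; rewrite negb_exists => /forallP noadj.
  by exists v => //; apply/forall_inP => u uS; have := noadj u; rewrite uS.
rewrite sumr_const -[leLHS]mulr_natl ler_wpM2r ?exprn_ge0 ?ler_nat; try lra.
by rewrite -[leqRHS]card_ord max_card.
Qed.

(* Markov's inequality. *)
Lemma gnp_prob_nondom_count (p : R) (i : nat) : 0 <= p <= 1 -> (i < n)%N ->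
  gnp_prob p (fun G => 'C(n, i) < nondom_count 'I_n G i * i.+1)%N
    <= n%:R ^+ 2 * (1 - p) ^+ i.
Proof.
move=> p01 lt_i; have C_gt0 : 0 < 'C(n, i)%:R :> R.
  by rewrite ltr0n bin_gt0 ltnW.
(* Scaling by the threshold reduces the claim to a comparison on each graph, without division. *)
rewrite -(ler_pM2l C_gt0).
have nondomE G : (nondom_count 'I_n G i)%:R =
    \sum_(S : {set 'I_n} | #|S| == i) (~~ dominating G S)%:R :> R.
  rewrite /nondom_count -sum1dep_card natr_sum big_mkcondl /=.
  by apply: eq_bigr => S _; case: (dominating G S).
apply: le_trans (_ : i.+1%:R * \sum_(S : {set 'I_n} | #|S| == i)
    gnp_prob p (fun G => ~~ dominating G S) <= _).
  under [X in _ <= _ * X]eq_bigr do rewrite gnp_probE.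
  rewrite exchange_big gnp_probE !mulr_sumr /=; apply: ler_sum => G _.
  rewrite -mulr_sumr -nondomE mulrCA [leRHS]mulrCA.
  rewrite ler_wpM2l ?gnp_mass_ge0 // -!natrM ler_nat.
  by case: ltnP => [/ltnW|_]; rewrite ?muln0 // muln1 mulnC.
(* The second factor [n] comes from [i.+1 <= n]. *)
apply: le_trans (_ : n%:R * \sum_(S : {set 'I_n} | #|S| == i)
    (n%:R * (1 - p) ^+ i) <= _).
  apply: ler_pM; rewrite ?ler0n ?ler_nat //.
    by apply: sumr_ge0 => S _; apply: sumr_ge0 => G _; apply: gnp_mass_ge0.
  by apply: ler_sum => S /eqP <-; apply: gnp_prob_nondominating.
rewrite sumr_const -cardsE card_draws card_ord -[X in _ * X <= _]mulr_natl.
by rewrite expr2 -!mulrA mulrCA.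
Qed.

Lemma gnp_prob_not_unimodal (p : R) : 0 <= p <= 1 ->
  gnp_prob p (fun G : sgraph 'I_n =>
    ~~ unimodal_with_mode (domination_poly R G) (uphalf n))
    <= n%:R ^+ 3 * (1 - p) ^+ uphalf n.
Proof.
move=> p01.
apply: le_trans (gnp_prob_union p _ _ (fun i : 'I_n => uphalf n <= i)%N
  (fun i G => 'C(n, i) < nondom_count 'I_n G i * i.+1)%N p01 _) _.
  move=> G; apply: contraNP => few.
  have := domination_poly_unimodal 'I_n G R; rewrite card_ord; apply=> i.
  move=> /andP[le_i lt_i]; rewrite leqNgt; apply/negP => many; apply: few.
  by exists (Ordinal lt_i).
(* Since [0 <= 1 - p <= 1], the smallest size gives the largest bound; the at most [n] sizes supply
   the third factor [n]. *)
apply: le_trans (_ : \sum_(i < n | (uphalf n <= i)%N)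
    n%:R ^+ 2 * (1 - p) ^+ uphalf n <= _).
  apply: ler_sum => i le_i; apply: le_trans (gnp_prob_nondom_count _ _ p01 _) _ => //.
  by rewrite ler_wpM2l ?exprn_ge0 ?ler0n // ler_wiXn2l //; lra.
rewrite sumr_const [n%:R ^+ 3]exprS -[leRHS]mulrA -[leLHS]mulr_natl ler_wpM2r //.
  by rewrite mulr_ge0 ?exprn_ge0 ?ler0n //; lra.
by rewrite ler_nat -[leqRHS]card_ord max_card.
Qed.

End RandomGraph.

(** * Passage to the limit *)

Local Open Scope classical_set_scope.

(** Each [s ^+ i] with [i < n] is at least [s ^+ n], so [n%:R * s ^+ n] is at most the geometric
    sum, itself at most [(1 - s)^-1]. *)
Lemma natr_mul_expr_le (R : realFieldType) (s : R) (n : nat) :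
  0 <= s < 1 -> n%:R * s ^+ n <= (1 - s)^-1.
Proof.
move=> /andP[s0 s1]; rewrite -[leRHS]mul1r ler_pdivlMr ?subr_gt0 //.
apply: le_trans (_ : 1 - s ^+ n <= 1); last by rewrite gerBl exprn_ge0.
rewrite -(opprB (s ^+ n) 1) subrX1 -mulNr opprB [leRHS]mulrC ler_wpM2r //; first lra.
rewrite mulr_natl -[X in _ *+ X]card_ord -sumr_const; apply: ler_sum => i _.
by rewrite ler_wiXn2l ?(ltW s1) // ltnW.
Qed.

Lemma cvg_cube_mul_expr_uphalf (R : realType) (p : R) : 0 < p < 1 ->
  (fun n : nat => n%:R ^+ 3 * (1 - p) ^+ uphalf n) @ \oo --> (0 : R).
Proof.
(* An eighth of [p] yields [(1 - p) ^+ uphalf n <= s ^+ (4 * n)]: three factors [s ^+ n] absorb the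
   cube, and the fourth tends to 0. *)
move=> hp; pose s := 1 - p / 8.
have s01 : 0 <= s < 1 by rewrite /s; lra.
(* Bernoulli's inequality: [1 - p <= (1 - p / 8) ^+ 8]. *)
have le_s : 1 - p <= s ^+ 8.
  have bern k : (k <= 8)%N -> 1 - k%:R * (p / 8) <= s ^+ k.
    elim: k => [|k IH] lt_k; first by rewrite expr0 mul0r subr0.
    (* With [x = p / 8], the product [(1 - k x)(1 - x)] exceeds [1 - (k + 1) x] by [k x^2]. *)
    have : 0 <= s * (s ^+ k - (1 - k%:R * (p / 8))).
      by rewrite mulr_ge0 ?subr_ge0 ?IH 1?ltnW //; lra.
    have : 0 <= k%:R * (p / 8) ^+ 2 by rewrite mulr_ge0 // exprn_ge0; lra.
    by rewrite [s ^+ k.+1]exprS -(natr1 k); move: (s ^+ k) => t; rewrite /s; lra.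
  by have := bern 8%N (leqnn _); lra.
apply: (@squeeze_cvgr _ _ _ _ (cst 0)
  (fun n => (1 - s)^-1 ^+ 3 * s ^+ n)); last 2 first.
- exact: cvg_cst.
- rewrite -[X in _ --> X](mulr0 ((1 - s)^-1 ^+ 3)).
  by apply: cvgMr; apply: cvg_expr; rewrite ger0_norm; lra.
apply: nearW => n; rewrite mulr_ge0 ?exprn_ge0 ?ler0n //=; last lra.
apply: le_trans (_ : (n%:R * s ^+ n) ^+ 3 * s ^+ n <= _); last first.
  rewrite ler_wpM2r ?exprn_ge0 //; first lra.
  by rewrite lerXn2r ?nnegrE ?invr_ge0 ?mulr_ge0 ?exprn_ge0 ?natr_mul_expr_le //; lra.
rewrite exprMn -[leRHS]mulrA ler_wpM2l ?exprn_ge0 ?ler0n // -exprM -exprD.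
apply: le_trans (_ : (s ^+ 8) ^+ uphalf n <= _).
  by rewrite lerXn2r // nnegrE ?exprn_ge0 //; lra.
(* The exponents compare because [4 * n <= 8 * uphalf n]. *)
by rewrite -exprM ler_wiXn2l //; [lra|lra|lia].
Qed.

Theorem theorem3p3 (R : realType) (p : R) (hp : 0 < p < 1) :
  (fun n : nat => gnp_prob p
     (fun G : sgraph 'I_n => unimodal_with_mode (domination_poly R G) (uphalf n)))
    @ \oo --> (1 : R).
Proof.
have p01 : 0 <= p <= 1 by lra.
apply: (@squeeze_cvgr _ _ _ _
  (fun n : nat => 1 - n%:R ^+ 3 * (1 - p) ^+ uphalf n) (cst 1)); last 2 first.
- rewrite -[X in _ --> X](subr0 (1 : R)).
  by apply: cvgB; [exact: cvg_cst|exact: cvg_cube_mul_expr_uphalf].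
- exact: cvg_cst.
apply: nearW => n.
(* The total mass 1 splits into the good and the bad event, so bounding the bad one from both sides
   squeezes the good one. *)
have := gnp_mass_sum1 n p.
rewrite (bigID (fun G : sgraph 'I_n =>
  unimodal_with_mode (domination_poly R G) (uphalf n))) /=.
rewrite -/(gnp_prob p _) -/(gnp_prob p (fun G => ~~ _)) => sum1.
have := gnp_prob_not_unimodal _ n p p01.
have : 0 <= gnp_prob p (fun G : sgraph 'I_n =>
    ~~ unimodal_with_mode (domination_poly R G) (uphalf n)).
  by apply: sumr_ge0 => G _; apply: gnp_mass_ge0.
by move=> ge0 le_bad; apply/andP; split; lra.
Qed.
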